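(* Let $\mathbb T=\mathbb R/(2\pi\mathbb Z)$, let $n\ge 2$, $M,c_0,c_1>0$, and let $\mathcal A_n=\mathcal A_n(M,c_0,c_1)$ be the admissible class of curves. Assume that the family of remainder operators $\{\mathcal R_{\boldsymbol X}\}_{\boldsymbol X\in\mathcal A_n}$ is an admissible remainder family with integer parameters $m\ge1$, $0\le\mu\le m$, $0\le\nu<n$ and constants $M_R,L_R$. Then there is a constant $C$, independent of $r$ and of $\boldsymbol X$, such that for each integer $r\ge m$ one can choose functions $a_1,\dots,a_r$ on $\mathbb T$, independently of $\boldsymbol X$, such that for every $\boldsymbol X\in\mathcal A_n$ there are functions $b_1(\cdot;\boldsymbol X),\dots,b_r(\cdot;\boldsymbol X)$ on $\mathbb T$ defining $$\mathcal R_{\boldsymbol X,r}f(s)=\sum_{k=1}^r a_k(s)\,c_k^{\boldsymbol X}(f),\qquad c_k^{\boldsymbol X}(f)=\int_{\mathbb T}b_k(t;\boldsymbol X)f(t)\,dt,$$ with $$\|\mathcal R_{\boldsymbol X}-\mathcal R_{\boldsymbol X,r}\|_{L^2(\mathbb T)\to L^\infty(\mathbb T)}+\|\mathcal R_{\boldsymbol X}-\mathcal R_{\boldsymbol X,r}\|_{L^2(\mathbb T)\to L^2(\mathbb T)}\le C\,r^{-m}.$$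
   Context: Admissible curves: for an integer $n\ge2$ and constants $M,c_0,c_1>0$, $$\mathcal A_n(M,c_0,c_1)=\Big\{\boldsymbol X\in C^n(\mathbb T;\mathbb R^2):\ \|\boldsymbol X\|_{C^n(\mathbb T)}\le M,\ |\boldsymbol X'(s)|\ge c_0,\ |\boldsymbol X(s)-\boldsymbol X(t)|\ge c_1\big|2\sin\tfrac{s-t}{2}\big|\ \text{for all }s,t\in\mathbb T\Big\}.$$ Remainder operator: for $\boldsymbol X\in\mathcal A_n$, let $\Omega$ be the bounded domain enclosed by $\boldsymbol X(\mathbb T)$; for $f$ on $\mathbb T$ let $u$ solve $\Delta u=0$ in $\Omega$, $u\circ\boldsymbol X=f$, and put $\breve\Lambda_{\boldsymbol X}f=(\partial_{\boldsymbol n}u\circ\boldsymbol X)\,|\boldsymbol X'|$ with $\boldsymbol n$ the outward unit normal. Let $\mathcal W_0$ be the Fourier multiplier on $\mathbb T$ with symbol $|k|/2$. Then $\mathcal R_{\boldsymbol X}=\breve\Lambda_{\boldsymbol X}-2\mathcal W_0$. Admissible remainder family: fix integers $m\ge1$, $0\le\mu\le m$, $0\le\nu<n$. The family is called admissible if for every $\boldsymbol X\in\mathcal A_n$ one has $\mathcal R_{\boldsymbol X}f(s)=\int_{\mathbb T}R(s,t;\boldsymbol X)f(t)\,dt$ (and $\mathcal R_{\boldsymbol X}$ on $L^2(\mathbb T)$ denotes this integral operator), with $$\sup_{\boldsymbol X\in\mathcal A_n}\|R(\cdot,\cdot;\boldsymbol X)\|_{C^m(\mathbb T^2)}\le M_R,$$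 $$\|R(\cdot,\cdot;\boldsymbol X)-R(\cdot,\cdot;\boldsymbol Y)\|_{C^\mu(\mathbb T^2)}\le L_R\|\boldsymbol X-\boldsymbol Y\|_{C^\nu(\mathbb T)}\quad\text{for all }\boldsymbol X,\boldsymbol Y\in\mathcal A_n,$$ for finite constants $M_R,L_R$. *)

(* Defs.v *)
From mathcomp Require Import all_boot all_order all_algebra.
From mathcomp Require Import complex.
From mathcomp Require Import all_classical all_reals all_analysis.
Import Order.TTheory GRing.Theory Num.Theory.
Import numFieldNormedType.Exports.

Set Implicit Arguments.
Unset Strict Implicit.
Unset Printing Implicit Defensive.

Local Open Scope classical_set_scope.
Local Open Scope ring_scope.

(** A function on the circle T = R/(2 pi Z) is a 2pi-periodic function on R, and
    a function on T^2 is a function on R * R that is 2pi-periodic in each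
    variable. *)

Definition biperiodic (R : realType) (F : R * R -> R) : Prop :=
  (forall t, periodic (fun s => F (s, t)) (pi *+ 2)) /\
  (forall s, periodic (fun t => F (s, t)) (pi *+ 2)).

Definition circle_measure (R : realType)
    : {measure set (measurableTypeR R) -> \bar R} :=
  [the measure _ _ of mrestr (@lebesgue_measure R)
    (measurable_itv (Interval (BLeft (0 : R)) (BLeft (pi *+ 2))))].

(** The product type [R * R] carries the sup norm in the library, so the
    Euclidean norm of the plane is defined here; the topologies agree. *)

Definition dot (R : realType) (p q : R * R) : R := p.1 * q.1 + p.2 * q.2.

Definition enorm (R : realType) (p : R * R) : R := Num.sqrt (dot p p).

Definition e1 (R : realType) : R * R := (1, 0).

Definition e2 (R : realType) : R * R := (0, 1).

Definition Ck (R : realType) (V : normedModType R) (k : nat) (f : R -> V)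
    : Prop :=
  (forall j, (j < k)%N -> forall s, derivable (derive1n j f) s 1) /\
  continuous (derive1n k f).

Fixpoint Ck2 (R : realType) (A : set (R * R)) (k : nat) (F : R * R -> R)
    : Prop :=
  if k is k'.+1 then
    [/\ forall p, A p -> [/\ {for p, continuous F}, derivable F p (e1 R)
                           & derivable F p (e2 R)],
        Ck2 A k' ('D_(e1 R) F) & Ck2 A k' ('D_(e2 R) F)]
  else forall p, A p -> {for p, continuous F}.

Definition curve_norm (R : realType) (k : nat) (X : R -> R * R) : \bar R :=
  (\sum_(j < k.+1) ereal_sup (range (fun s => (enorm (derive1n j X s))%:E)))%E.

Definition partial (R : realType) (i j : nat) (F : R * R -> R) : R * R -> R :=
  iter i (fun G => 'D_(e1 R) G) (iter j (fun G => 'D_(e2 R) G) F).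

Definition kernel_norm (R : realType) (k : nat) (F : R * R -> R) : \bar R :=
  (\sum_(i < k.+1) \sum_(j < k.+1 | (i + j <= k)%N)
     ereal_sup (range (fun p => (`|partial i j F p|%R)%:E)))%E.

Definition admissible_curve (R : realType) (n : nat) (M c0 c1 : R)
    (X : R -> R * R) : Prop :=
  [/\ periodic X (pi *+ 2) /\ Ck n X,
      (curve_norm n X <= M%:E)%E,
      forall s, c0 <= enorm (derive1 X s)
    & forall s t, c1 * `|2 * sin ((s - t) / 2)| <= enorm (X s - X t)].

(** The bounded component of the complement of the Jordan curve [X]. *)
Definition enclosed_domain (R : realType) (X : R -> R * R) : set (R * R) :=
  [set p | (~` range X) p /\ bounded_set (connected_component (~` range X) p)].

(** The curves are not assumed to be positively oriented, so the outward
    direction is determined by the position of the domain. *)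
Definition outward_unit_normal (R : realType) (X : R -> R * R) (s : R)
    (v : R * R) : Prop :=
  [/\ enorm v = 1, dot v (derive1 X s) = 0
    & \forall h \near 0^'+, enclosed_domain X (X s - h *: v) /\
                            ~ closure (enclosed_domain X) (X s + h *: v)].

Definition dirichlet_solution (R : realType) (X : R -> R * R) (f : R -> R)
    (u : R * R -> R) : Prop :=
  let Omega := enclosed_domain X in
  [/\ {within closure Omega, continuous u},
      Ck2 Omega 2 u,
      forall p, Omega p ->
        'D_(e1 R) ('D_(e1 R) u) p + 'D_(e2 R) ('D_(e2 R) u) p = 0
    & forall s, u (X s) = f s].

(** The normal derivative at a boundary point is one-sided, taken from inside
    the domain. *)
Definition normal_derivative (R : realType) (u : R * R -> R) (p v : R * R)
    (d : R) : Prop :=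
  h^-1 * (u p - u (p - h *: v)) @[h --> 0^'+] --> d.

Definition dirichlet_to_neumann (R : realType) (X : R -> R * R) (f g : R -> R)
    : Prop :=
  exists2 u, dirichlet_solution X f u &
    forall s, exists v d, [/\ outward_unit_normal X s v,
      normal_derivative u (X s) v d & g s = d * enorm (derive1 X s)].

(** [fourier_coeff f k] is (2 pi)^-1 times the integral of f(t) exp(- i k t). *)
Definition fourier_coeff (R : realType) (f : R -> R) (k : int) : R[i] :=
  Complex
    ((pi *+ 2)^-1 * \int[@circle_measure R]_t (f t * cos (k%:~R * t)))
    (- ((pi *+ 2)^-1 * \int[@circle_measure R]_t (f t * sin (k%:~R * t)))).

(** [w] is the continuous function obtained from [f] by the Fourier multiplier
    with the given symbol. *)
Definition fourier_multiplier (R : realType) (symbol : int -> R[i])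
    (f w : R -> R) : Prop :=
  [/\ periodic w (pi *+ 2), continuous w
    & forall k, fourier_coeff w k = symbol k * fourier_coeff f k].

Definition W0 (R : realType) (f w : R -> R) : Prop :=
  fourier_multiplier (fun k => Complex (`|k|%:~R / 2) 0) f w.

Definition remainder (R : realType) (X : R -> R * R) (f h : R -> R) : Prop :=
  exists g w, [/\ dirichlet_to_neumann X f g, W0 f w
                & forall s, h s = g s - 2 * w s].

Definition kernel_op (R : realType) (K : R * R -> R) (f : R -> R) : R -> R :=
  fun s => \int[@circle_measure R]_t (K (s, t) * f t).

(** The pointwise identity between the remainder operator and its kernel is
    required on smooth data, where both sides are classically defined; on L^2
    the remainder operator is the integral operator [kernel_op (K X)]. *)
Definition admissible_remainder_family (R : realType) (n : nat) (M c0 c1 : R)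
    (m mu nu : nat) (MR LR : R) (K : (R -> R * R) -> R * R -> R) : Prop :=
  [/\ forall X, admissible_curve n M c0 c1 X ->
        forall f, periodic f (pi *+ 2) -> (forall k, Ck k f) ->
          remainder X f (kernel_op (K X) f),
      forall X, admissible_curve n M c0 c1 X ->
        [/\ biperiodic (K X), Ck2 setT m (K X)
          & (kernel_norm m (K X) <= MR%:E)%E]
    & forall X Y, admissible_curve n M c0 c1 X ->
        admissible_curve n M c0 c1 Y ->
        (kernel_norm mu (fun p => K X p - K Y p)%R
           <= LR%:E * curve_norm nu (fun s => X s - Y s)%R)%E].

Definition Lp_circle (R : realType) (p : \bar R) (f : R -> R) : Prop :=
  periodic f (pi *+ 2) /\ f \in Lfun (@circle_measure R) p.

Definition opnorm (R : realType) (p q : \bar R) (A : (R -> R) -> (R -> R))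
    : \bar R :=
  ereal_sup [set Lnorm (@circle_measure R) q (EFin \o A f) | f in
    [set f | Lp_circle p f /\
             (Lnorm (@circle_measure R) p (EFin \o f) <= 1)%E]].

Definition functional (R : realType) (b f : R -> R) : R :=
  \int[@circle_measure R]_t (b t * f t).

Definition finite_rank_op (R : realType) (r : nat) (a b : 'I_r -> R -> R)
    (f : R -> R) : R -> R :=
  fun s => \sum_(k < r) a k s * functional (b k) f.

(* Main.v *)
Require Import Defs.
From mathcomp Require Import all_boot all_order all_algebra.
From mathcomp Require Import all_classical all_reals all_analysis.
From mathcomp Require Import ess_sup_inf measurable_realfun.
From mathcomp Require Import ring.
Import Order.TTheory GRing.Theory Num.Theory.
Import numFieldNormedType.Exports.
Set Implicit Arguments.
Unset Strict Implicit.
Unset Printing Implicit Defensive.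
Local Open Scope classical_set_scope.
Local Open Scope ring_scope.

(** The kernel [F = K X] is bounded together with its first [m] derivatives in
    the variable [s], by a constant [MR] that does not depend on [X]. Cut the
    circle into [N = r %/ m] equal arcs of length [h = 2 pi / N] and replace
    [F(., t)] on each arc by its Taylor polynomial of degree [m - 1] at the left
    end [j h] of the arc. The approximation reads
<<
      F(s, t) ~ \sum_(j < N) \sum_(i < m)
                  1_arc_j(s) (s - j h)^i / i! * (d/ds)^i F(j h, t),
>>
    which separates the variables in [N m <= r] terms: the factors in [s]
    (localized monomials) are the same for all curves, and only the
    factors in [t] depend on [X]. The Taylor remainder is at most [MR h^m], and
    [r < 2 N m] turns this into a constant times [r^-m] uniformly in [X].

    The passage from kernels to operators is Hoelder's inequality with exponents
    2 and 2: a kernel bounded by [e] defines an operator of norm at most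
    [e sqrt(2 pi)] from L^2 to L^oo, and at most [2 pi e] from L^2 to L^2. The
    estimate for the kernels is [piecewise_taylor_le], the one for the operators
    is [finite_rank_error_le].

    The functions [a_k] may be discontinuous, which is why piecewise polynomials
    can take the place of a trigonometric approximation, at the same rate. *)

(** * Taylor expansion with a uniform remainder *)

Lemma is_derive_taylor_term (R : realType) (c a x : R) (i : nat) :
  is_derive x (1 : R) (fun s => c * ((s - a) ^+ i.+1 / i.+1`!%:R))
    (c * ((x - a) ^+ i / i`!%:R)).
Proof.
have -> : (fun s => c * ((s - a) ^+ i.+1 / i.+1`!%:R)) =
    (c / i.+1`!%:R) *: (shift (- a) ^+ i.+1).
  apply/funext => s; have E : (shift (- a) ^+ i.+1) s = (s - a) ^+ i.+1.
    by rewrite exprfctE.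
  by rewrite -E mulrA mulrAC.
have dS := is_derive_shift x (1 : R) (- a).
apply: is_derive_eq; rewrite /= /GRing.scale/= mulr1 factS natrM invfM.
have n0 : i.+1%:R != 0 :> R by rewrite pnatr_eq0.
rewrite -!mulrA; congr (c * _); rewrite mulrCA [in RHS]mulrC; congr (_ * _).
by rewrite mulrA mulVf// mul1r.
Qed.

(** Induction on [m]: the derivative of the remainder of order [m.+1] of [D 0] is
    the remainder of order [m] of [D 1], and the mean value theorem trades it for
    one more factor [s - a]. The factor [1 / m!] of the sharp bound is dropped. *)
Lemma taylor_remainder_le (R : realType) (m : nat) (D : nat -> R -> R) (B a : R) :
  (forall i s, (i < m)%N -> is_derive s (1 : R) (D i) (D i.+1 s)) ->
  (forall s, `|D m s| <= B) ->
  forall s, a <= s ->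
  `|D 0 s - \sum_(i < m) D i a * ((s - a) ^+ i / i`!%:R)| <= B * (s - a) ^+ m.
Proof.
elim: m D => [|m IH] D dD DB s ags.
  by rewrite big_ord0 subr0 expr0 mulr1.
have {}IH := IH (fun i => D i.+1) (fun i s => dD i.+1 s) DB.
have B0 : 0 <= B by exact: le_trans (normr_ge0 _) (DB 0).
pose P s := \sum_(i < m.+1) D i a * ((s - a) ^+ i / i`!%:R).
pose dP s := \sum_(i < m) D i.+1 a * ((s - a) ^+ i / i`!%:R).
have PE : P = cst (D 0 a) +
    \sum_(i < m) (fun s => D i.+1 a * ((s - a) ^+ i.+1 / i.+1`!%:R)).
  apply/funext => x; rewrite /P big_ord_recl expr0 fact0 invr1 !mulr1.
  by rewrite [RHS]/GRing.add/= fct_sumE.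
have dEP x : is_derive x (1 : R) (D 0 - P) (D 1%N x - dP x).
  apply: is_deriveB; first exact: dD.
  rewrite PE -[dP x]add0r; apply: is_deriveD.
  by apply: is_derive_sum => i; exact: is_derive_taylor_term.
have Pa : P a = D 0 a.
  rewrite /P big_ord_recl expr0 fact0 invr1 !mulr1 big1 ?addr0// => i _.
  by rewrite subrr expr0n/= mul0r mulr0.
have cEP : {within `[a, s], continuous (D 0 - P)}.
  apply: continuous_subspaceT => x; apply/differentiable_continuous/derivable1_diffP.
  by have [] := dEP x.
have [x /[!in_itv]/= /andP[ax xs]] := MVT_segment ags (fun x _ => dEP x) cEP.
have -> : (D 0 - P) a = 0 by rewrite /GRing.add/= /GRing.opp/= Pa subrr.
rewrite subr0 => /= E.
have -> : D 0 s - P s = (D 0 - P) s by [].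
rewrite E normrM exprSr mulrA (ger0_norm (_ : 0 <= s - a)) ?subr_ge0//.
rewrite ler_wpM2r ?subr_ge0// (le_trans (IH x ax))//.
by rewrite ler_wpM2l// lerXn2r ?nnegrE ?subr_ge0// lerB.
Qed.

(** * Partial derivatives of a kernel *)

Lemma Ck2_iter (R : realType) (m i : nat) (F : R * R -> R) :
  (i <= m)%N -> Ck2 setT m F -> Ck2 setT (m - i) (partial i 0 F).
Proof.
elim: i m F => [|i IH] m F; first by rewrite subn0.
case: m => // m lim [_ HF _]; rewrite subSS /partial iterSr.
exact: (IH m ('D_(e1 R) F)).
Qed.

Lemma Ck2_continuous (R : realType) (m : nat) (F : R * R -> R) :
  Ck2 setT m F -> continuous F.
Proof. by case: m => [|m] /= => [H p|[H _ _] p]; [exact: H|case: (H p I)]. Qed.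

Lemma scale_e1D (R : realType) (h s t : R) :
  h *: e1 R + (s, t) = (h * 1 + s, t).
Proof. by rewrite -[LHS]/(h * 1 + s, h * 0 + t) mulr0 add0r. Qed.

Lemma is_derive_section (R : realType) (F : R * R -> R) (s t : R) :
  derivable F (s, t) (e1 R) ->
  is_derive s (1 : R) (fun x => F (x, t)) ('D_(e1 R) F (s, t)).
Proof.
have E : (fun h : R => h^-1 *: ((F \o shift (s, t)) (h *: e1 R) - F (s, t))) =
  (fun h : R => h^-1 *: (((fun x => F (x, t)) \o shift s) (h *: (1:R)) - F (s, t))).
  by apply/funext => h /=; rewrite scale_e1D.
by move=> dF; apply: DeriveDef; rewrite /derivable /derive -?E.
Qed.

(** Differentiation in the first variable commutes with translations in the
    second, so periodicity in [t] passes to the derivatives. *)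
Lemma periodic_derive (R : realType) (F : R * R -> R) (T : R) :
  (forall s, periodic (fun t => F (s, t)) T) ->
  (forall s, periodic (fun t => 'D_(e1 R) F (s, t)) T).
Proof.
move=> HF s t; rewrite /derive.
suff -> : (fun h : R =>
    h^-1 *: ((F \o shift (s, t + T)) (h *: e1 R) - F (s, t + T))) =
   (fun h : R => h^-1 *: ((F \o shift (s, t)) (h *: e1 R) - F (s, t))) by [].
by apply/funext => h /=; rewrite !scale_e1D !HF.
Qed.

Lemma le_kernel_norm (R : realType) (k i j : nat) (F : R * R -> R)
    (B : R) (p : R * R) :
  (i + j <= k)%N -> (kernel_norm k F <= B%:E)%E -> `|partial i j F p| <= B.
Proof.
move=> ijk FB; rewrite -lee_fin; apply: le_trans FB; rewrite /kernel_norm.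
pose S i j : \bar R := ereal_sup (range (fun p => (`|partial i j F p|)%:E)).
have S0 i' j' : (0 <= S i' j')%E.
  by apply: le_trans (ereal_sup_ubound _); last (by exists p); rewrite lee_fin.
have ik : (i < k.+1)%N by rewrite ltnS (leq_trans (leq_addr _ _) ijk).
have jk : (j < k.+1)%N by rewrite ltnS (leq_trans (leq_addl _ _) ijk).
rewrite (bigD1 (Ordinal ik))//= (bigD1 (Ordinal jk))//=.
apply: le_trans (leeDl _ _); last by do 2 apply: sume_ge0 => *; exact: S0.
apply: le_trans (leeDl _ _); last by apply: sume_ge0 => *; exact: S0.
by apply: ereal_sup_ubound; exists p.
Qed.

(** * Monomials localized on the arcs of the circle *)

Lemma periodicz (R : realType) (f : R -> R) (T : R) :
  periodic f T -> forall (k : int) x, f (x + T *~ k) = f x.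
Proof.
move=> fT [n|n] x; first exact: periodicn.
by rewrite NegzE mulrNz -(periodicn fT n.+1 (x - _)) subrK.
Qed.

Section angle.
Context {R : realType}.
Local Notation tau := (pi *+ 2 : R).

Lemma tau_gt0 : 0 < tau. Proof. by rewrite pmulrn_rgt0// pi_gt0. Qed.

(** The representative in [[0, 2 pi[] of a point of the circle. *)
Definition angle (s : R) : R := s - tau * (Num.floor (s / tau))%:~R.

Lemma angle_itv s : 0 <= angle s < tau.
Proof.
have /andP[fl fu] := floor_itv (s / tau).
rewrite /angle mulrC subr_ge0 -ler_pdivlMr ?tau_gt0// fl/= ltrBlDl.
by rewrite -[X in _ + X]mul1r -mulrDl -ltr_pdivrMr ?tau_gt0// -intrD1.
Qed.

Lemma angle_periodic : periodic angle tau.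
Proof.
move=> s; rewrite /angle (mulrDl s tau) divff ?gt_eqF ?tau_gt0//.
rewrite floorDrz ?rpred1// floor1 intrD (mulrDr tau) mulr1 opprD addrACA.
by rewrite subrr addr0.
Qed.

Lemma comp_angle (f : R -> R) s : periodic f tau -> f (angle s) = f s.
Proof. by move=> fT; rewrite /angle mulrzr -mulrNz periodicz. Qed.

Lemma measurable_angle : measurable_fun setT angle.
Proof.
apply: measurable_funB => //; apply: measurable_funM => //.
apply: nondecreasing_measurable => // x y xy.
by rewrite ler_int le_floor// ler_pM2r// invr_gt0 tau_gt0.
Qed.

(** Cut off to the [j]-th of [N] equal arcs; going through [angle] makes the
    function periodic. *)
Definition arc_monomial (N j i : nat) (s : R) : R :=
  let h := tau / N%:R in
  \1_`[j%:R * h, j.+1%:R * h[ (angle s) * ((angle s - j%:R * h) ^+ i / i`!%:R).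

Lemma arc_monomial_periodic N j i : periodic (arc_monomial N j i) tau.
Proof. by move=> s; rewrite /arc_monomial angle_periodic. Qed.

Lemma measurable_arc_monomial N j i : measurable_fun setT (arc_monomial N j i).
Proof.
apply: measurable_funM.
  exact: (measurableT_comp (measurable_indic _) measurable_angle).
apply: measurable_funM => //; apply: measurable_funX.
by apply: measurable_funB => //; exact: measurable_angle.
Qed.

Lemma arc_monomial_bounded N j i s :
  `|arc_monomial N j i s| <= (tau / N%:R) ^+ i.
Proof.
rewrite /arc_monomial indicE; set h := tau / _.
have h0 : 0 <= h by rewrite divr_ge0// ltW// tau_gt0.
have [|_] := boolP (_ \in _); last by rewrite mul0r normr0 exprn_ge0.
rewrite inE/= in_itv/= => /andP[l u]; rewrite mul1r.
have y0 : 0 <= angle s - j%:R * h by rewrite subr_ge0.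
rewrite ger0_norm ?divr_ge0 ?exprn_ge0//.
rewrite (@le_trans _ _ ((angle s - j%:R * h) ^+ i))//.
  by rewrite ler_pdivrMr ?ltr0n ?fact_gt0// ler_peMr ?exprn_ge0// ler1n fact_gt0.
rewrite -natr1 mulrDl mul1r in u.
by rewrite lerXn2r ?nnegrE// lerBlDl ltW.
Qed.

Lemma arcP N s : (0 < N)%N -> exists2 j, (j < N)%N &
  angle s \in `[j%:R * (tau / N%:R), j.+1%:R * (tau / N%:R)[%R.
Proof.
move=> N0; have /andP[a0 at_] := angle_itv s.
have h0 : 0 < tau / N%:R by rewrite divr_gt0 ?tau_gt0// ltr0n.
have := truncn_itv (divr_ge0 a0 (ltW h0)).
rewrite ler_pdivlMr// ltr_pdivrMr// => /[dup] aj /andP[l _].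
exists (Num.trunc (angle s / (tau / N%:R))); last by rewrite in_itv.
rewrite -(ltr_nat R) -(ltr_pM2r h0) (le_lt_trans l)// (mulrC N%:R) divfK//.
by rewrite pnatr_eq0 -lt0n.
Qed.

Lemma arc_monomial_eq N j j' i s :
  angle s \in `[j%:R * (tau / N%:R), j.+1%:R * (tau / N%:R)[%R ->
  arc_monomial N j' i s =
    if j' == j then (angle s - j%:R * (tau / N%:R)) ^+ i / i`!%:R else 0.
Proof.
rewrite in_itv/= => /andP[jl ju]; rewrite /arc_monomial indicE.
have [->|j'j] := eqVneq j' j.
  by rewrite mem_set ?mul1r//= in_itv/= jl.
rewrite memNset ?mul0r//= in_itv/= => /andP[j'l j'u].
have h0 : 0 <= tau / N%:R by rewrite divr_ge0// ltW// tau_gt0.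
have ltE a b : a%:R * (tau / N%:R) < b%:R * (tau / N%:R) -> (a < b)%N.
  by apply: contraTT; rewrite -leqNgt -leNgt => ba; rewrite ler_wpM2r// ler_nat.
move/eqP: j'j; apply; apply/eqP; rewrite eqn_leq.
by rewrite -ltnS (ltE _ _ (le_lt_trans j'l ju)) -ltnS (ltE _ _ (le_lt_trans jl j'u)).
Qed.
End angle.

(** * Norms on the circle and bounded kernels *)

(** The integral of a nonnegative function is a supremum over the simple
    functions below it, hence is monotone without measurability. This makes it
    possible to bound the L^2 norm of the image of an integral operator
    from a pointwise bound, without a measurability argument for that image. *)
Lemma le_integral_nonmeasurable d (T : measurableType d) (R : realType)
    (mu : {measure set T -> \bar R}) (f g : T -> \bar R) :
  (forall x, (0 <= f x)%E) -> (forall x, (f x <= g x)%E) ->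
  (\int[mu]_x f x <= \int[mu]_x g x)%E.
Proof.
move=> f0 fg; have g0 x : (0 <= g x)%E by exact: le_trans (fg x).
rewrite !ge0_integralTE//; apply: le_ereal_sup => _ [h hf <-].
by exists h => // x; exact: le_trans (hf x) (fg x).
Qed.

Section circle.
Context {R : realType}.
Local Notation tau := (pi *+ 2 : R).
Local Notation mu := (@circle_measure R).

Lemma circle_measureT : mu setT = tau%:E.
Proof.
rewrite /circle_measure/= /mrestr setTI lebesgue_measure_itv/= lte_fin.
by rewrite tau_gt0 oppr0 adde0.
Qed.

Lemma Lnorm_infty_le (g : R -> R) (D : R) : (forall s, `|g s| <= D) ->
  (Lnorm mu +oo (EFin \o g) <= D%:E)%E.
Proof.
move=> gD; rewrite unlock circle_measureT lte_fin tau_gt0.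
by apply/ess_supP; apply: nearW => s; rewrite /= lee_fin.
Qed.

Lemma Lnorm2_le (g : R -> R) (D : R) : (forall s, `|g s| <= D) ->
  (Lnorm mu 2%:E (EFin \o g) <= (D * Num.sqrt tau)%:E)%E.
Proof.
move=> gD; have D0 : 0 <= D by exact: le_trans (gD 0).
have -> : (D * Num.sqrt tau)%:E = (((D ^+ 2)%:E * mu setT) `^ 2^-1)%E.
  have tau0 : 0 <= tau by rewrite ltW// tau_gt0.
  rewrite circle_measureT -EFinM poweR_EFin powRM ?sqr_ge0//.
  by rewrite !powR12_sqrt ?sqr_ge0// sqrtr_sqr ger0_norm.
rewrite unlock -integral_cst//; apply: gt0_ler_poweR => //.
- by rewrite in_itv/= leey integral_ge0// => x _; rewrite poweR_ge0.
- by rewrite in_itv/= leey integral_ge0// => x _; rewrite lee_fin sqr_ge0.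
apply: le_integral_nonmeasurable => x; first by rewrite poweR_ge0.
by rewrite /= lee_fin powR_mulrn// lerXn2r ?nnegrE.
Qed.

Lemma bounded_Lfun_infty (f : R -> R) (B : R) :
  measurable_fun setT f -> (forall s, `|f s| <= B) -> f \in Lfun mu +oo%E.
Proof.
move=> mf fB; rewrite inE; apply/andP; split; rewrite inE//=.
by rewrite /finite_norm (le_lt_trans (Lnorm_infty_le fB)) ?ltry.
Qed.

Lemma bounded_Lfun2 (f : R -> R) (B : R) :
  measurable_fun setT f -> (forall s, `|f s| <= B) -> f \in Lfun mu 2%:E.
Proof.
move=> mf fB; rewrite inE; apply/andP; split; rewrite inE//=.
by rewrite /finite_norm (le_lt_trans (Lnorm2_le fB)) ?ltry.
Qed.

Lemma integrable_bounded_mul (g f : R -> R) (B : R) :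
  measurable_fun setT g -> (forall s, `|g s| <= B) -> f \in Lfun mu 2%:E ->
  mu.-integrable setT (EFin \o (fun t => g t * f t)).
Proof.
move=> mg gB f2; apply/Lfun1_integrable.
exact: Lfun2_mul_Lfun1 (bounded_Lfun2 mg gB) f2.
Qed.

(** Hoelder's inequality with exponents 2 and 2; [Num.sqrt tau] is the L^2 norm
    of the constant 1. *)
Lemma Rintegral_bounded_mul_le (g f : R -> R) (B : R) :
  measurable_fun setT g -> (forall s, `|g s| <= B) ->
  f \in Lfun mu 2%:E -> (Lnorm mu 2%:E (EFin \o f) <= 1)%E ->
  `|\int[mu]_t (g t * f t)| <= B * Num.sqrt tau.
Proof.
move=> mg gB f2 f1; have B0 : 0 <= B by exact: le_trans (gB 0).
have ig := integrable_bounded_mul mg gB f2.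
have mf : measurable_fun setT f by have /sub_Lfun_mfun/set_mem := f2.
rewrite -lee_fin EFin_normr_Rintegral//.
apply: le_trans (le_abse_integral _ _ _) _ => //; first exact: measurable_int ig.
rewrite -[leLHS](Lnorm1 mu (EFin \o (g \* f))).
apply: le_trans (@hoelder _ _ _ mu g f 2 2 mg mf _ _ _) _ => //.
  by rewrite [RHS]splitr !div1r.
rewrite -[leRHS]mule1; by apply: lee_pmul; rewrite ?Lnorm_ge0//; exact: Lnorm2_le.
Qed.

(** Sum and integral may be exchanged since each [b i] is bounded, so that its
    product with the L^2 function [f] is integrable. *)
Lemma Rintegral_sum_mul (I : Type) (r : seq I) (c : I -> R) (b : I -> R -> R)
    (B : I -> R) (f : R -> R) :
  (forall i, measurable_fun setT (b i)) -> (forall i t, `|b i t| <= B i) ->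
  f \in Lfun mu 2%:E ->
  \sum_(i <- r) c i * functional (b i) f =
    \int[mu]_t ((\sum_(i <- r) c i * b i t) * f t).
Proof.
move=> mb bB f2.
have msum r' : measurable_fun setT (fun t => \sum_(i <- r') c i * b i t).
  by apply: measurable_sum => i; exact: measurable_funM.
have sumB r' t : `|\sum_(i <- r') c i * b i t| <= \sum_(i <- r') `|c i| * B i.
  rewrite (le_trans (ler_norm_sum _ _ _))// ler_sum// => i _.
  by rewrite normrM ler_wpM2l.
elim: r => [|i r IH].
  rewrite big_nil; under eq_Rintegral do rewrite big_nil mul0r.
  by rewrite Rintegral_cst// mul0r.
have ib := integrable_bounded_mul (mb i) (bB i) f2.
rewrite big_cons IH /functional -RintegralZl// -RintegralD//.
- by apply: eq_Rintegral => t _; rewrite big_cons [RHS]mulrDl mulrA.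
- exact: integrableZl ib.
- exact: integrable_bounded_mul (msum r) (sumB r) f2.
Qed.

Lemma opnorm_le (p q : \bar R) (A : (R -> R) -> R -> R) (D : \bar R) :
  (forall f, Lp_circle p f -> (Lnorm mu p (EFin \o f) <= 1)%E ->
    (Lnorm mu q (EFin \o A f) <= D)%E) ->
  (opnorm p q A <= D)%E.
Proof. by move=> AD; apply: ge_ereal_sup => _ [f [fp f1] <-]; exact: AD. Qed.

End circle.

(** * Piecewise Taylor approximation of a kernel *)

(** Among the indices [k = j * m + i] with [i < m], only one block of [m]
    consecutive indices belongs to a given arc [j]. *)
Lemma sum_block (V : nmodType) (m r j : nat) (G : nat -> V) :
  (0 < m)%N -> (j.+1 * m <= r)%N ->
  \sum_(k < r) (if (k %/ m == j)%N then G (k %% m)%N else 0) = \sum_(i < m) G i.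
Proof.
move=> m0 jr; pose H k := if (k %/ m == j)%N then G (k %% m)%N else 0.
have jj : (j * m <= j.+1 * m)%N by rewrite leq_mul2r leqnSn orbT.
rewrite -(big_mkord xpredT H) -(big_mkord xpredT G).
rewrite (big_cat_nat (n := j.+1 * m))//= (big_cat_nat (n := j * m))//=.
rewrite big_nat_cond big1 ?add0r; last first.
  by move=> k /andP[/andP[_ kj] _]; rewrite /H ltn_eqF// ltn_divLR.
rewrite [X in _ + X]big_nat_cond [X in _ + X]big1 ?addr0; last first.
  by move=> k /andP[/andP[kj _] _]; rewrite /H gtn_eqF// leq_divRL.
rewrite -[in LHS](add0n (j * m)%N) mulSn big_addn addnK.
apply: eq_big_nat => i /andP[_ im].
by rewrite /H addnC divnMDl// modnMDl divn_small// addn0 modn_small// eqxx.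
Qed.

Section approximation.
Context {R : realType}.
Local Notation tau := (pi *+ 2 : R).
Local Notation mu := (@circle_measure R).
Variables (m N r : nat) (F : R * R -> R) (B : R).
Hypotheses (m0 : (0 < m)%N) (N0 : (0 < N)%N) (Nmr : (N * m <= r)%N).
Hypotheses (perF : biperiodic F) (CF : Ck2 setT m F).
Hypothesis (FB : (kernel_norm m F <= B%:E)%E).

Local Notation h := (tau / N%:R).

(** The index [k] encodes the arc [k %/ m] and the order [k %% m]; the factorial
    is carried by [arc_monomial]. *)
Definition taylor_coeff (k : nat) (t : R) : R :=
  partial (k %% m) 0 F ((k %/ m)%:R * h, t).

Let FiB i p : (i <= m)%N -> `|partial i 0 F p| <= B.
Proof. by move=> im; apply: le_kernel_norm FB; rewrite addn0. Qed.

Lemma partial_periodic i s : periodic (fun t => partial i 0 F (s, t)) tau.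
Proof.
elim: i s => [|i IH] s; first exact: perF.2.
exact: periodic_derive IH s.
Qed.

Lemma measurable_partial i s : (i <= m)%N ->
  measurable_fun setT (fun t => partial i 0 F (s, t)).
Proof.
move=> im; apply: continuous_measurable_fun => t.
apply: (@continuous_comp _ _ _ (pair s) (partial i 0 F)).
  exact: (@cvg_pair _ _ _ (nbhs t) (nbhs s) (nbhs t) _ _ _ (cst s) id
    (cvg_cst s) cvg_id).
exact: Ck2_continuous (Ck2_iter im CF) _.
Qed.

Lemma partial_is_derive i s t : (i < m)%N ->
  is_derive s (1 : R) (fun x => partial i 0 F (x, t)) (partial i.+1 0 F (s, t)).
Proof.
move=> im; apply: is_derive_section.
have := Ck2_iter (ltnW im) CF; rewrite -(subnSK im) => -[H _ _].
by have [] := H (s, t) I.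
Qed.

(** For a fixed [s] the sum over [k] collapses to the Taylor polynomial at the
    left end of the arc that contains [s], whose length is [h]. *)
Lemma piecewise_taylor_le s t :
  `|F (s, t) - \sum_(k < r) arc_monomial N (k %/ m) (k %% m) s * taylor_coeff k t|
    <= B * h ^+ m.
Proof.
have B0 : 0 <= B by exact: le_trans (normr_ge0 _) (FiB (0, 0) (leqnn m)).
have [j jN sj] := arcP s N0; pose a := j%:R * h.
have -> : \sum_(k < r) arc_monomial N (k %/ m) (k %% m) s * taylor_coeff k t =
    \sum_(i < m) partial i 0 F (a, t) * ((angle s - a) ^+ i / i`!%:R).
  rewrite -(sum_block (r := r) (j := j)
    (fun i => partial i 0 F (a, t) * ((angle s - a) ^+ i / i`!%:R)))//; last first.
    by rewrite (leq_trans _ Nmr)// leq_mul2r jN orbT.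
  apply: eq_bigr => k _; rewrite (arc_monomial_eq _ _ sj).
  by case: eqP => [kj|_]; rewrite ?mul0r// mulrC /taylor_coeff kj.
have /andP[] := sj; rewrite !bnd_simp -/a => aj ja.
rewrite -(comp_angle s (perF.1 t)).
apply: le_trans (taylor_remainder_le
  (D := fun i x => partial i 0 F (x, t)) (B := B) _ _ aj) _.
- by move=> i x im; exact: partial_is_derive.
- by move=> x; exact: FiB.
rewrite ler_wpM2l// lerXn2r ?nnegrE ?subr_ge0//.
  by rewrite divr_ge0// ltW// tau_gt0.
by rewrite lerBlDl ltW// (lt_le_trans ja)// -natr1 mulrDl mul1r.
Qed.

Lemma taylor_coeff_Lp2 k : Lp_circle 2%:E (taylor_coeff k).
Proof.
have km : (k %% m <= m)%N by rewrite ltnW// ltn_pmod.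
split; first exact: partial_periodic.
by apply: (@bounded_Lfun2 _ _ B); [exact: measurable_partial|move=> t; exact: FiB].
Qed.

(** The error operator is again an integral operator, whose kernel is the Taylor
    remainder. *)
Lemma finite_rank_error_le f s : f \in Lfun mu 2%:E ->
  (Lnorm mu 2%:E (EFin \o f) <= 1)%E ->
  `|kernel_op F f s - finite_rank_op
      (fun k : 'I_r => arc_monomial N (k %/ m) (k %% m)) taylor_coeff f s|
    <= B * h ^+ m * Num.sqrt tau.
Proof.
move=> f2 f1.
have km k : (k %% m <= m)%N by rewrite ltnW// ltn_pmod.
have mb (k : 'I_r) : measurable_fun setT (taylor_coeff k).
  exact: measurable_partial.
have bB (k : 'I_r) t : `|taylor_coeff k t| <= B by exact: FiB.
have mF : measurable_fun setT (fun t => F (s, t)) by exact: (@measurable_partial 0).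
have FB0 t : `|F (s, t)| <= B by exact: (@FiB 0).
pose c (k : 'I_r) := arc_monomial N (k %/ m) (k %% m) s : R.
have mS : measurable_fun setT (fun t => \sum_(k < r) c k * taylor_coeff k t).
  by apply: measurable_sum => k; exact: measurable_funM.
have SB t : `|\sum_(k < r) c k * taylor_coeff k t| <= B * h ^+ m + B.
  (* The sum is the kernel minus the Taylor remainder, both bounded. *)
  rewrite -[X in `|X|](subKr (F (s, t))) (le_trans (ler_normB _ _))// addrC lerD//.
  exact: piecewise_taylor_le.
rewrite /finite_rank_op (Rintegral_sum_mul _ c mb bB f2) /kernel_op.
rewrite -RintegralB//; last 2 first.
- exact: integrable_bounded_mul mF FB0 f2.
- exact: integrable_bounded_mul mS SB f2.
under eq_Rintegral do rewrite -mulrBl.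
apply: Rintegral_bounded_mul_le f2 f1; first exact: measurable_funB.
by move=> t; exact: piecewise_taylor_le.
Qed.

End approximation.

Lemma arc_monomial_Linfty (R : realType) (N j i : nat) :
  Lp_circle +oo%E (@arc_monomial R N j i).
Proof.
split; first exact: arc_monomial_periodic.
exact: bounded_Lfun_infty (measurable_arc_monomial N j i)
  (@arc_monomial_bounded R N j i).
Qed.

(** * The finite-rank approximation of the remainder operators *)

Theorem theorem5p2 (R : realType) (n m mu nu : nat) (M c0 c1 MR LR : R)
    (K : (R -> R * R) -> R * R -> R)
    (hn : (2 <= n)%N) (hM : 0 < M) (hc0 : 0 < c0) (hc1 : 0 < c1)
    (hm : (1 <= m)%N) (hmu : (mu <= m)%N) (hnu : (nu < n)%N)
    (hK : admissible_remainder_family n M c0 c1 m mu nu MR LR K) :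
  exists C : R, forall r : nat, (m <= r)%N ->
    exists a : 'I_r -> R -> R,
      (forall k, Lp_circle +oo%E (a k)) /\
      forall X : R -> R * R, admissible_curve n M c0 c1 X ->
        exists b : 'I_r -> R -> R,
          (forall k, Lp_circle 2%:E (b k)) /\
          let A := fun (f : R -> R) (s : R) =>
            kernel_op (K X) f s - finite_rank_op a b f s in
          (opnorm 2%:E +oo%E A + opnorm 2%:E 2%:E A
             <= (C * r%:R ^- m)%:E)%E.
Proof.
pose tau : R := pi *+ 2.
(* [h <= 2 m tau / r], and [sqrt tau + tau] adds up the two operator norms. *)
exists (MR * (2 * m%:R * tau) ^+ m * (Num.sqrt tau + tau)) => r mr.
pose N := (r %/ m)%N.
have N0 : (0 < N)%N by rewrite divn_gt0.
have Nmr : (N * m <= r)%N by exact: leq_trunc_div.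
exists (fun k => arc_monomial N (k %/ m) (k %% m)); split=> [k|X hX].
  exact: arc_monomial_Linfty.
have [_ /(_ X hX)[perF CF FB] _] := hK.
exists (fun k => taylor_coeff m N (K X) k); split=> [k|A].
  exact: taylor_coeff_Lp2 perF CF FB k.
have tau0 : 0 < tau by exact: tau_gt0.
have r0 : (0 < r)%N by exact: leq_trans mr.
pose D := MR * (tau / N%:R) ^+ m * Num.sqrt tau.
have AD f : Lp_circle 2%:E f ->
    (Lnorm (@circle_measure R) 2%:E (EFin \o f) <= 1)%E ->
    forall s, `|A f s| <= D.
  by move=> [_ f2] f1 s; exact: finite_rank_error_le f2 f1.
have MR0 : 0 <= MR.
  have := le_kernel_norm (0, 0) (leq0n m : (0 + 0 <= m)%N) FB.
  exact: le_trans.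
(* [r < N.+1 * m <= 2 * N * m], as [N] is positive. *)
have Nr : tau / N%:R <= (2 * m%:R * tau) / r%:R.
  rewrite ler_pdivrMr ?ltr0n// mulrAC ler_pdivlMr ?ltr0n//.
  rewrite mulrC [leRHS]mulrAC ler_pM2r//.
  rewrite -!natrM ler_nat.
  apply: (leq_trans (ltnW (ltn_ceil r hm))).
  by rewrite mulnAC leq_mul2r mul2n -addnn -addn1 leq_add2l N0 orbT.
apply: (@le_trans _ _ (D%:E + (D * Num.sqrt tau)%:E)%E).
  apply: leeD; apply: opnorm_le => f fp f1.
    exact: Lnorm_infty_le (AD f fp f1).
  exact: Lnorm2_le (AD f fp f1).
rewrite -EFinD lee_fin /D -[X in _ <= _ * (_ + X) * _](sqr_sqrtr (ltW tau0)).
set q := Num.sqrt tau.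
have -> : MR * (tau / N%:R) ^+ m * q + MR * (tau / N%:R) ^+ m * q * q =
  MR * (q + q ^+ 2) * (tau / N%:R) ^+ m by ring.
have -> : MR * (2 * m%:R * tau) ^+ m * (q + q ^+ 2) / r%:R ^+ m =
  MR * (q + q ^+ 2) * ((2 * m%:R * tau) / r%:R) ^+ m.
  by rewrite expr_div_n; ring.
rewrite ler_wpM2l ?mulr_ge0 ?addr_ge0 ?sqr_ge0 ?sqrtr_ge0//.
rewrite lerXn2r ?nnegrE// divr_ge0 ?mulr_ge0//; exact: ltW.
Qed.
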